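(* Let $G$ and $H$ be graphs, each with at least $3$ vertices, and suppose $G$ is connected. Then $$\lambda_3(G\circ H)\ \ge\ \lambda_3(H)+\lambda_3(G)\,|V(H)|.$$ Moreover, this lower bound is sharp: there exist such $G,H$ for which equality holds.
   Context: All graphs are simple, finite and undirected. For a graph $G$ and a set $S\subseteq V(G)$ with $|S|\ge 2$, an $S$-tree (Steiner tree connecting $S$) is a subgraph of $G$ that is a tree containing all vertices of $S$. $\lambda(S)$ (also written $\lambda_G(S)$) is the maximum number of pairwise edge-disjoint $S$-trees in $G$. The generalized $k$-edge-connectivity is $\lambda_k(G)=\min\{\lambda(S): S\subseteq V(G),\ |S|=k\}$, with the convention $\lambda_k(G)=0$ if $G$ is disconnected. The lexicographic product $G\circ H$ has vertex set $V(G)\times V(H)$, and $(u,v)$ is adjacent to $(u',v')$ iff either $uu'\in E(G)$, or $u=u'$ and $vv'\in E(H)$. *)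

(* Defs.v *)
From mathcomp Require Import all_boot.
Set Implicit Arguments. Unset Strict Implicit. Unset Printing Implicit Defensive.

Definition simple_graph (T : finType) (g : rel T) : Prop :=
  symmetric g /\ irreflexive g.

Definition connected_graph (T : finType) (g : rel T) : bool :=
  [forall x, forall y, connect g x y].

Definition lexprod (T1 T2 : finType) (g : rel T1) (h : rel T2) : rel (T1 * T2) :=
  fun p q => g p.1 q.1 || ((p.1 == q.1) && h p.2 q.2).

Definition is_subgraph (T : finType) (g : rel T) (V : {set T}) (E : {set {set T}}) : bool :=
  [forall e in E, [exists x in V, exists y in V, g x y && (e == [set x; y])]].

Definition subgraph_connected (T : finType) (V : {set T}) (E : {set {set T}}) : bool :=
  [forall x in V, forall y in V, connect (fun a b => [set a; b] \in E) x y].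

Definition is_tree (T : finType) (g : rel T) (V : {set T}) (E : {set {set T}}) : bool :=
  [&& is_subgraph g V E, V != set0, subgraph_connected V E & #|E| == #|V|.-1].

Definition is_Stree (T : finType) (g : rel T) (S : {set T})
  (t : {set T} * {set {set T}}) : bool :=
  is_tree g t.1 t.2 && (S \subset t.1).

Definition has_disjoint_Strees (T : finType) (g : rel T) (S : {set T}) (k : nat) : bool :=
  [exists f : {ffun 'I_k -> {set T} * {set {set T}}},
     [forall i, is_Stree g S (f i)] &&
     [forall i, forall j, (i != j) ==> [disjoint (f i).2 & (f j).2]]].

(* lambda(S): the maximum number of pairwise edge-disjoint S-trees.  Any family of
   k >= 1 such trees (|S| >= 2) has k distinct nonempty edge sets, so k <= #|{set T}|;
   the bound below is thus not restrictive. *)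
Definition lambdaS (T : finType) (g : rel T) (S : {set T}) : nat :=
  \max_(k < #|{set T}|.+1 | has_disjoint_Strees g S k) k.

Definition lambda_k (T : finType) (g : rel T) (k : nat) : nat :=
  if connected_graph g then
    \big[minn/#|{set T}|]_(S : {set T} | #|S| == k) lambdaS g S
  else 0.

(* Main.v *)
Require Import Defs.
From mathcomp Require Import all_boot ssralg zmodp.
Set Implicit Arguments. Unset Strict Implicit. Unset Printing Implicit Defensive.

(** Edge-disjoint S-trees may be replaced by edge-disjoint edge sets connecting
    S, since each contains a spanning tree.  Let n = |V(H)|.  Each of lambda_3(G)
    edge-disjoint trees of G meeting the fibres of S contains a tripod: a hub w
    with edge-disjoint legs to three given vertices.  A Latin square turns a leg
    from u to w into n^2 edge-disjoint links, one between each (u, s) and each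
    (w, t), so everything reduces to distributing links.  According to how S is
    spread over the fibres, the links of one tripod yield n connecting sets, and
    enough links remain free to join up, through copies of H in the fibres,
    lambda_3(H) further ones; these are added for a single tree of G.
    Equality holds for the path on three vertices and the empty graph on three
    vertices, where a vertex in the fibre of a leaf has degree 3. *)

(** * Edge sets, connectivity and Steiner trees *)

Definition edges (T : finType) (g : rel T) : {set {set T}} :=
  [set e | [exists x, exists y, g x y && (e == [set x; y])]].

Definition conn (T : finType) (E : {set {set T}}) : rel T :=
  connect (fun x y => [set x; y] \in E).

Definition connects (T : finType) (E : {set {set T}}) (S : {set T}) : Prop :=
  {in S &, forall x y, conn E x y}.

Definition disjoint_family (I : Type) (T : finType) (P : I -> {set T}) : Prop :=
  forall i j e, e \in P i -> e \in P j -> i = j.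

(** Connecting sets stand in for trees. The index type plays the role of the number of sets, so
    packings combine along sums and products of types. *)
Definition packs (T : finType) (g : rel T) (S : {set T}) (I : Type) : Prop :=
  exists P : I -> {set {set T}},
    [/\ forall i, P i \subset edges g, disjoint_family P
      & forall i, connects (P i) S].

Section Connectivity.
Variable T : finType.
Implicit Types (g : rel T) (E F : {set {set T}}) (S V : {set T}) (x y z : T).

Lemma edgesP g (e : {set T}) :
  reflect (exists x y, g x y /\ e = [set x; y]) (e \in edges g).
Proof.
rewrite inE; apply: (iffP existsP) => [[x /existsP[y /andP[gxy /eqP->]]]|[x [y [gxy ->]]]].
  by exists x, y.
by exists x; apply/existsP; exists y; rewrite gxy eqxx.
Qed.

Lemma conn_sym E : symmetric (conn E).
Proof. by apply: sym_connect_sym => x y; rewrite setUC. Qed.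

Lemma conn_trans E : transitive (conn E).
Proof. exact: connect_trans. Qed.

Lemma conn1 E x y : [set x; y] \in E -> conn E x y.
Proof. by move=> xyE; apply: connect1. Qed.

Lemma connS E F x y : E \subset F -> conn E x y -> conn F x y.
Proof.
by move=> /subsetP EF; apply: connect_sub => u v /EF uvF; apply: connect1.
Qed.

Lemma connects_hub E S p :
  {in S, forall x, conn E p x} -> connects E S.
Proof.
by move=> hub x y xS yS; apply: (@conn_trans _ p); rewrite ?hub // conn_sym hub.
Qed.

Lemma conn_boundary E (V : {set T}) x y : conn E x y -> x \in V -> y \notin V ->
  exists u v, [/\ [set u; v] \in E, u \in V & v \notin V].
Proof.
case/connectP=> p; elim: p x => [|z p IH] x /= => [_ -> ->//|/andP[xzE pth] ylast xV yV].
case: (boolP (z \in V)) => zV; first exact: IH pth ylast zV yV.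
by exists x, z.
Qed.

Lemma conn_first_edge E x y : conn E x y -> x != y ->
  exists2 z, z != x & [set x; z] \in E.
Proof.
move=> xy nxy; have := @conn_boundary E [set x] x y xy (set11 x).
rewrite inE eq_sym nxy => /(_ isT)[u [v [uvE /set1P ux]]]; rewrite inE => nvx.
by exists v; rewrite // -ux.
Qed.

(* A maximal tree through a fixed vertex of S inside E must contain S. *)
Lemma connects_Stree g E (S : {set T}) : E \subset edges g -> S != set0 ->
  connects E S -> exists2 t, is_Stree g S t & t.2 \subset E.
Proof.
move=> /subsetP Eg /set0Pn[x xS] conS.
(* Subtrees of [E] through [x]: connected from [x], with one edge fewer than vertices. Both
   properties survive the addition of a leaf. *)
pose good (t : {set T} * {set {set T}}) :=
  [&& x \in t.1, t.2 \subset E, [forall e in t.2, e \subset t.1],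
      [forall v in t.1, conn t.2 x v] & #|t.2| == #|t.1|.-1].
have good0 : good ([set x], set0).
  rewrite /good /= set11 sub0set cards0 cards1 eqxx andbT /=; apply/andP; split.
    by apply/forall_inP => e; rewrite inE.
  by apply/forall_inP => v /set1P->; apply: connect0.
pose t := [arg max_(t > ([set x], set0) | good t) #|t.1|].
have : good t /\ forall t', good t' -> #|t'.1| <= #|t.1|.
  by rewrite /t; case: arg_maxnP => // ? ? ?; split.
case: t => V E' []; rewrite /good /= => /and5P[xV sE' /forall_inP EV /forall_inP hub /eqP card] tmax.
exists (V, E') => //=; apply/andP; split; last first.
  apply/subsetP => s sS; apply/negPn/negP => sV.
  have [u [v [uvE uV vV]]] := conn_boundary (conS _ _ xS sS) xV sV.
  have nuv : [set u; v] \notin E'.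
    by apply: contra vV => /EV/subsetP; apply; rewrite !inE eqxx orbT.
  suff /tmax : good (v |: V, [set u; v] |: E') by rewrite /= cardsU1 vV ltnn.
  rewrite /good /= !inE xV orbT subUset sub1set uvE sE' !cardsU1 nuv vV card /=.
  apply/and3P; split.
  - apply/forall_inP => e /setU1P[->|/EV]; last by move/subset_trans; apply; apply: subsetUr.
    by rewrite subUset !sub1set !inE uV eqxx orbT.
  - have sU : E' \subset [set u; v] |: E' by apply: subsetUr.
    apply/forall_inP => r /setU1P[->|/hub]; last exact: connS.
    apply: (@conn_trans _ u); first by apply: connS (hub _ uV).
    by apply: conn1; rewrite setU11.
  by rewrite !add1n prednK //; apply/card_gt0P; exists x.
apply/and4P; split; rewrite ?card //=.
- apply/forall_inP => e eE'; have /edgesP[a [b [gab eab]]] := Eg _ (subsetP sE' _ eE').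
  have /subsetP eV := EV _ eE'.
  apply/exists_inP; exists a; first by rewrite eV // eab !inE eqxx.
  apply/exists_inP; exists b; first by rewrite eV // eab !inE eqxx orbT.
  by rewrite gab eab /=.
- by apply/set0Pn; exists x.
by apply/forall_inP => a /hub xa; apply/forall_inP => b /hub; apply: conn_trans; rewrite conn_sym.
Qed.

Lemma Stree_sub_edges g (S : {set T}) t : is_Stree g S t -> t.2 \subset edges g.
Proof.
case/andP=> /and4P[/forall_inP sg _ _ _] _; apply/subsetP => e /sg.
move=> /exists_inP[x _ /exists_inP[y _ /andP[gxy /eqP->]]].
by apply/edgesP; exists x, y.
Qed.

Lemma Stree_connects g (S : {set T}) t : is_Stree g S t -> connects t.2 S.
Proof.
case/andP=> /and4P[_ _ /forall_inP con _] /subsetP ST x y /ST xt /ST yt.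
exact: (forall_inP (con _ xt)).
Qed.

(** [S] has a second vertex, so every set must contain an edge leaving [c]; disjointness makes these
    edges distinct. They bound packings by degrees and later give the exits of the extra sets. *)
Lemma packing_neighbours (I : Type) (P : I -> {set {set T}}) (S : {set T}) c :
  (forall (i : I), connects (P i) S) -> disjoint_family P -> 1 < #|S| -> c \in S ->
  forall i, exists2 v, v != c & [set c; v] \in P i.
Proof.
move=> con dis; rewrite (cardD1 c) => S2 cS i; move: S2; rewrite cS.
case/card_gt0P=> d; rewrite !inE => /andP[ndc dS].
by apply: conn_first_edge (con i _ _ cS dS) _; rewrite eq_sym.
Qed.

End Connectivity.

(** * Packings and the generalized edge-connectivity *)

Section Lambda.
Variables (T : finType) (g : rel T).
Implicit Types (S : {set T}) (I : finType).

Lemma disjoint_choice_inj (I : Type) (U : finType) (P : I -> {set U}) (f : I -> U) :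
  disjoint_family P -> (forall i, f i \in P i) -> injective f.
Proof. by move=> dis fP i j fij; apply: dis (fP i) _; rewrite fij. Qed.

Lemma edges_pair c v : symmetric g -> v != c -> [set c; v] \in edges g -> g c v.
Proof.
move=> gsym nvc /edgesP[x [y [gxy /setP eq_cv]]].
have := eq_cv c; have := eq_cv v; rewrite !inE !eqxx orbT /= => /esym/orP vxy /esym/orP cxy.
case: vxy cxy nvc => /eqP-> [] /eqP-> //; rewrite ?eqxx // => _.
by rewrite gsym.
Qed.

Lemma packs_degree I S c : symmetric g -> 1 < #|S| -> c \in S -> packs g S I ->
  #|I| <= #|[set v | g c v]|.
Proof.
move=> gsym S2 cS [P [Pg dis con]].
have [f fc fP] := fin_all_exists2 (packing_neighbours con dis S2 cS).
have f_inj : injective f.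
  by move=> i j fij; apply: (disjoint_choice_inj dis fP); rewrite fij.
rewrite -cardsT -(card_imset _ f_inj); apply/subset_leq_card/subsetP => _ /imsetP[i _ ->].
by rewrite inE edges_pair // (subsetP (Pg i)).
Qed.

Lemma packs_card I S : 1 < #|S| -> packs g S I -> #|I| <= #|{set T}|.
Proof.
move=> S2 [P [_ dis con]]; have /card_gt0P[c cS] : 0 < #|S| by apply: ltnW.
have [f _ fP] := fin_all_exists2 (packing_neighbours con dis S2 cS).
exact: leq_card (disjoint_choice_inj dis fP).
Qed.

(** Shrinking each connecting set to a tree keeps the family disjoint, and [packs_card] puts its
    size in the range of the maximum. *)
Lemma packs_lambdaS I S : 1 < #|S| -> packs g S I -> #|I| <= lambdaS g S.
Proof.
move=> S2 pk; have leI := packs_card S2 pk; case: pk => P [Pg dis con].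
have S0 : S != set0 by rewrite -card_gt0 ltnW.
have [t tS tP] := fin_all_exists2 (fun i => connects_Stree (Pg i) S0 (con i)).
have ltI : #|I| < #|{set T}|.+1 by [].
apply: (leq_bigmax_cond (Ordinal ltI)); apply/existsP.
exists [ffun k => t (enum_val k)]; apply/andP; split.
  by apply/forallP => k; rewrite ffunE.
apply/forallP => k; apply/forallP => l; apply/implyP => nkl; rewrite !ffunE.
rewrite -setI_eq0; apply: contraR nkl => /set0Pn[e /setIP[ek el]].
by apply/eqP/enum_val_inj; apply: dis (subsetP (tP _) _ ek) (subsetP (tP _) _ el).
Qed.

Lemma packs_inj (I J : Type) S (f : I -> J) : injective f -> packs g S J -> packs g S I.
Proof.
move=> f_inj [P [Pg dis con]]; exists (P \o f); split=> [i|i j e ei ej|i] /=; [exact: Pg | | exact: con].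
by apply: f_inj; apply: dis ei ej.
Qed.

Lemma lambdaS_packs S k : k <= lambdaS g S -> packs g S 'I_k.
Proof.
(* The empty family is admissible, so the maximum is attained by some index [l]; a smaller [k] keeps
   only part of that family. *)
have ex0 : 0 < #|[pred k : 'I_#|{set T}|.+1 | has_disjoint_Strees g S k]|.
  apply/card_gt0P; exists ord0; apply/existsP.
  exists [ffun=> (set0, set0)]; apply/andP; split; first by apply/forallP=> -[].
  by apply/forallP=> -[].
have [l] := eq_bigmax_cond (fun k : 'I_#|{set T}|.+1 => k : nat) ex0.
rewrite inE => /existsP[f /andP[/forallP fS /forallP fdis]] max_l.
rewrite (_ : lambdaS g S = l) // => le_kl.
apply: (@packs_inj _ 'I_l S (widen_ord le_kl)); first by move=> i j /(congr1 val)/=/val_inj.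
exists (fun i => (f i).2); split=> [i|i j e ei ej|i]; last exact: (@Stree_connects _ _ _ _ (fS i)).
  exact: Stree_sub_edges (fS i).
apply/eqP; apply: contraTT ej => nij; have := forallP (fdis i) j; rewrite nij /=.
by move/disjointFr => ->.
Qed.

Lemma lambda_k_le (k : nat) S : #|S| = k -> lambda_k g k <= lambdaS g S.
Proof.
rewrite /lambda_k => /eqP cS; case: ifP => // _.
have : S \in index_enum {set T} by rewrite mem_index_enum.
elim: (index_enum _) => // A r IH; rewrite in_cons big_cons => /predU1P[<-|/IH le_r].
  by rewrite cS geq_minl.
by case: ifP => // _; rewrite geq_min le_r orbT.
Qed.

Lemma lambda_k_packs (k : nat) S : #|S| = k -> packs g S 'I_(lambda_k g k).
Proof. by move/lambda_k_le/lambdaS_packs. Qed.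

Lemma exists_superset (A : {set T}) (k : nat) : #|A| <= k <= #|T| ->
  exists2 B : {set T}, A \subset B & #|B| = k.
Proof.
elim: k => [|k IH] /andP[]; first by rewrite leqn0 => /eqP cA _; exists A.
rewrite leq_eqVlt => /predU1P[<- _|ltAk ltkT]; first by exists A.
have [|B AB cB] := IH; first by rewrite -ltnS ltAk ltnW.
have /set0Pn[x] : ~: B != set0 by rewrite -card_gt0 cardsCs setCK cB subn_gt0.
rewrite inE => xB; exists (x |: B); last by rewrite cardsU1 xB cB.
exact: subset_trans AB (subsetUr _ _).
Qed.

Lemma packs_lambda_k I (k : nat) : 1 < k <= #|T| -> connected_graph g ->
  (forall S, #|S| = k -> packs g S I) -> #|I| <= lambda_k g k.
Proof.
move=> /andP[k2 kT] cg pk; rewrite /lambda_k cg.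
have ge_k S : #|S| == k -> #|I| <= lambdaS g S.
  by move=> /eqP cS; apply: packs_lambdaS (pk _ cS); rewrite cS.
(* A packing for one [k]-set bounds [#|I|] by [#|{set T}|], the value at which the minimum
   starts. *)
have [|S _ cS] := @exists_superset set0 k; first by rewrite cards0.
elim/big_ind: _ => [|m n|//]; last by rewrite leq_min => ->.
by apply: packs_card (pk _ cS); rewrite cS.
Qed.

Lemma connected_graph_conn : connected_graph g -> forall x y, conn (edges g) x y.
Proof.
move=> /forallP cg x y; have := forallP (cg x) y; apply: connect_sub => u v guv.
by apply/conn1/edgesP; exists u, v.
Qed.

Lemma connected_graph_edges : symmetric g ->
  (forall x y, conn (edges g) x y) -> connected_graph g.
Proof.
move=> gsym con; apply/forallP => x; apply/forallP => y.
apply: connect_sub (con x y) => u v uvE.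
by have [->|nuv] := eqVneq v u; [exact: connect0 | exact/connect1/edges_pair].
Qed.

Lemma lambda_k_gt0 (k : nat) : 1 < k <= #|T| -> connected_graph g -> 0 < lambda_k g k.
Proof.
move=> kT cg; rewrite -card_unit; apply: packs_lambda_k => // S _.
exists (fun=> edges g); split=> // [[] [] //|_ x y _ _].
exact: connected_graph_conn.
Qed.

End Lambda.

(** * Links between fibres *)

Section Links.
Variables T1 T2 : finType.
Implicit Types (E F : {set {set T1}}).

(** When [E] consists of two-element sets, this joins the fibres of the two ends of each edge
    completely. *)
Definition blowup E : {set {set T1 * T2}} :=
  [set e : {set T1 * T2} | (#|e| == 2) && (fst @: e \in E)].

Lemma imset_fst_pair (p q : T1 * T2) : fst @: [set p; q] = [set p.1; q.1].
Proof. by rewrite imsetU1 imset_set1. Qed.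

Lemma blowup_pair E (p q : T1 * T2) :
  p.1 != q.1 -> [set p.1; q.1] \in E -> [set p; q] \in blowup E.
Proof.
move=> npq pqE; rewrite inE imset_fst_pair pqE cards2 andbT.
by have [pq|//] := eqVneq p q; rewrite pq eqxx in npq.
Qed.

Lemma pair_set_inj (x y : T1) (i j i' j' : T2) : x != y ->
  [set (x, i); (y, j)] = [set (x, i'); (y, j')] -> i = i' /\ j = j'.
Proof.
move=> nxy /setP eq_s; have := eq_s (x, i); have := eq_s (y, j).
rewrite !inE !eqxx orbT /= !xpair_eqE !eqxx (negPf nxy) eq_sym (negPf nxy) /= orbF.
by move=> /esym/eqP-> /esym/eqP->.
Qed.

(** The addition table of a cyclic group, transported by an enumeration. The empty type is separate
    because the group lives on ['I_n.+1]. *)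
Lemma latin_square : exists k : T2 -> T2 -> T2,
  (forall i, injective (k i)) /\ (forall j, injective (k^~ j)).
Proof.
case n_def : #|T2| => [|n].
  by exists (fun i _ => i); split=> x y; have := fintype0 x n_def.
pose r x : 'I_n.+1 := cast_ord n_def (enum_rank x).
have r_inj : injective r by move=> x y /cast_ord_inj/enum_rank_inj.
exists (fun i j => enum_val (cast_ord (esym n_def) (GRing.add (r i) (r j)))).
split=> [i x y /enum_val_inj/cast_ord_inj/GRing.addrI/r_inj //|].
by move=> j x y /enum_val_inj/cast_ord_inj/GRing.addIr/r_inj.
Qed.

(* The Latin square routes the n^2 links through the middle fibre so that no
   edge of either complete bipartite half is used twice. *)
Lemma path_links E x p : path (fun u v => [set u; v] \in E) x p -> uniq (x :: p) ->
  p != [::] -> exists Q : T2 -> T2 -> {set {set T1 * T2}},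
  [/\ forall i j, conn (Q i j) (x, i) (last x p, j),
      forall i j e, e \in Q i j -> e \in blowup E /\ {subset fst @: e <= x :: p}
    & forall i j i' j' e, e \in Q i j -> e \in Q i' j' -> i = i' /\ j = j'].
Proof.
elim: p x => // y p IH x /= /andP[xyE pth] /andP[xyp uniq_yp] _.
have nxy : x != y by apply: contraNneq xyp => ->; rewrite mem_head.
have [p0|p_n0] := eqVneq p [::].
  exists (fun i j => [set [set (x, i); (y, j)]]); rewrite p0; split=> [i j|i j e|i j i' j' e].
  - by apply: conn1; rewrite inE.
  - move/set1P->; split; first exact: blowup_pair.
    by rewrite imset_fst_pair => u; rewrite !inE.
  - by move=> /set1P-> /set1P; apply: pair_set_inj.
have [Q [Qc Qs Qd]] := IH _ pth uniq_yp p_n0.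
have [k [kl kr]] := latin_square.
(* [x] does not recur on the rest of the path, so first edges never occur in links of the tail. *)
have fresh i i' j l : [set (x, i); (y, j)] \in Q i' l -> False.
  move=> /Qs[_]; rewrite imset_fst_pair => /(_ x (set21 _ _)) xp.
  by rewrite xp in xyp.
(* Injective rows separate links with a common first edge; injective columns separate links with a
   common later edge. *)
exists (fun i j => [set (x, i); (y, k i j)] |: Q (k i j) j); split=> [i j|i j e|i j i' j' e].
- apply: (@conn_trans _ _ (y, k i j)); first by apply: conn1; rewrite setU11.
  exact: connS (subsetUr _ _) (Qc _ _).
- case/setU1P=> [->|/Qs[eE se]]; split=> //; first exact: blowup_pair.
    by rewrite imset_fst_pair => u; rewrite !inE orbA => ->.
  by move=> u /se; rewrite [in X in _ -> X]inE orbC => ->.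
case/setU1P=> [->|eQ] /setU1P[eq_e|eQ'].
- by have [eq_i + ] := pair_set_inj nxy eq_e; rewrite -eq_i => /kl.
- by case: (fresh _ _ _ _ eQ').
- by rewrite eq_e in eQ; case: (fresh _ _ _ _ eQ).
by have [+ eq_j] := Qd _ _ _ _ _ eQ eQ'; rewrite -eq_j => /kr.
Qed.

Lemma links E x z : conn E x z -> x != z -> exists Q : T2 -> T2 -> {set {set T1 * T2}},
  [/\ forall i j, conn (Q i j) (x, i) (z, j),
      forall i j, Q i j \subset blowup E
    & forall i j i' j' e, e \in Q i j -> e \in Q i' j' -> i = i' /\ j = j'].
Proof.
case/connectP=> p pth z_def nxz; rewrite {z}z_def in nxz *.
case/shortenP: pth nxz => q pth uniq_q _ nxq.
have q_n0 : q != [::] by apply: contraNneq nxq => ->.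
have [Q [Qc Qs Qd]] := path_links pth uniq_q q_n0.
by exists Q; split=> // i j; apply/subsetP => e /Qs[].
Qed.

End Links.

(** * Tripods *)

Section Tripod.
Variable T : finType.
Implicit Types (F : {set {set T}}) (V : {set T}) (x y z w : T).

(** Keeping only edges spanned by the path makes paths that share a single vertex edge-disjoint. *)
Lemma path_conn F x p : path (fun u v => [set u; v] \in F) x p ->
  conn [set e in F | e \subset x :: p] x (last x p).
Proof.
elim: p x => [|y p IH] x /=; first by move=> _; apply: connect0.
case/andP=> xyF /IH con; apply: (@conn_trans _ _ y).
  apply: conn1; rewrite inE xyF /=; apply/subsetP => u.
  by rewrite !inE => /orP[] ->; rewrite ?orbT.
apply: connS con; apply/subsetP => e; rewrite !inE => /andP[-> /subsetP se] /=.
by apply/subsetP => u /se; rewrite [in X in _ -> X]inE orbC => ->.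
Qed.

(** Walk from [y] until [V] is first met: every edge used starts outside [V]. *)
Lemma conn_attach F V x y : conn F y x -> x \in V -> exists w (L : {set {set T}}),
  [/\ w \in V, L \subset F, conn L w y & forall e, e \in L -> ~~ (e \subset V)].
Proof.
case/connectP=> p + ->; elim: p y => [|z p IH] y /= => [_ yV|/andP[yzF pth] xV].
  by exists y, set0; split; rewrite ?sub0set //; [apply: connect0 | move=> e; rewrite inE].
case: (boolP (y \in V)) => yV.
  by exists y, set0; split; rewrite ?sub0set //; [apply: connect0 | move=> e; rewrite inE].
have [w [L [wV LF wz LV]]] := IH _ pth xV.
exists w, ([set y; z] |: L); split=> //.
- by rewrite subUset sub1set yzF.
- apply: (@conn_trans _ _ z); first exact: connS (subsetUr _ _) wz.
  by rewrite conn_sym; apply: conn1; rewrite setU11.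
by move=> e /setU1P[->|/LV //]; rewrite subUset sub1set (negPf yV).
Qed.

(* w is the vertex at which a path from y first meets a simple path from x to z. *)
Lemma tripod F x y z : (forall e, e \in F -> #|e| = 2) -> uniq [:: x; y; z] ->
  conn F x y -> conn F x z -> exists w (L : T -> {set {set T}}),
  [/\ forall u, u \in [:: x; y; z] -> conn (L u) w u,
      forall u, L u \subset F & disjoint_family L].
Proof.
move=> F2 uniq_xyz xy /connectP[p0 pth0 z_def].
case/shortenP: pth0 z_def => p pth uniq_p _ z_def.
have [||w [L [wV LF wy LV]]] := @conn_attach F [set u in x :: p] x y.
- by rewrite conn_sym.
- by rewrite inE mem_head.
rewrite inE in wV; case/splitPl: wV pth uniq_p z_def LV => p1 p2 w_def.
rewrite cat_path last_cat w_def -cat_cons cat_uniq => /andP[pth1 pth2] /and3P[_ /hasPn disj uniq2] z_def LV.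
pose L1 := [set e in F | e \subset x :: p1]; pose L2 := [set e in F | e \subset w :: p2].
have sL1 e : e \in L1 -> e \subset [set u in x :: p1 ++ p2].
  rewrite inE => /andP[_ /subsetP se]; apply/subsetP => u /se.
  by rewrite inE -cat_cons mem_cat => ->.
have sL2 e : e \in L2 -> e \subset [set u in x :: p1 ++ p2].
  rewrite inE => /andP[_ /subsetP se]; apply/subsetP => u /se.
  rewrite inE [in X in X -> _]inE -cat_cons mem_cat => /predU1P[->|->]; last by rewrite orbT.
  by rewrite -w_def mem_last.
(* The two halves of the simple path share only [w], so a common edge would have at most one
   vertex. *)
have dL e : e \in L1 -> e \in L2 -> False.
  rewrite !inE => /andP[eF /subsetP se1] /andP[_ /subsetP se2].
  have : #|e| <= #|[set w]|.
    apply/subset_leq_card/subsetP => u ue; rewrite inE.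
    have := se2 _ ue; rewrite inE => /predU1P[-> //|/disj]; last by rewrite /= se1.
  by rewrite F2 // cards1.
move: uniq_xyz; rewrite /= !inE negb_or => /and3P[/andP[nxy nxz] nyz _].
(* Legs are indexed by their end; any other vertex receives the empty set. *)
exists w, (fun u => if u == x then L1 else if u == z then L2 else if u == y then L else set0).
split=> [u|u|u v e].
- rewrite !inE => /or3P[] /eqP->.
  + by rewrite eqxx conn_sym; have := path_conn pth1; rewrite w_def.
  + by rewrite eq_sym (negPf nxy) (negPf nyz) eqxx.
  + by rewrite eq_sym (negPf nxz) eqxx z_def; apply: path_conn.
- by do !case: ifP => // _; rewrite ?sub0set //; apply/subsetP => e; rewrite inE => /andP[].
have inL a : e \in (if a == x then L1 else if a == z then L2 else if a == y then L else set0) ->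
    [\/ a = x /\ e \in L1, a = z /\ e \in L2 | a = y /\ e \in L].
  have [->|_] := eqVneq a x; first by constructor 1.
  have [->|_] := eqVneq a z; first by constructor 2.
  by have [->|_] := eqVneq a y; [constructor 3 | rewrite inE].
have L1L : e \in L1 -> e \in L -> False by move=> /sL1 se /LV; rewrite se.
have L2L : e \in L2 -> e \in L -> False by move=> /sL2 se /LV; rewrite se.
by move=> /inL[] [-> e1] /inL[] [-> e2] //; do ?[by case: (dL e) | by case: L1L | by case: L2L].
Qed.

End Tripod.

(** * Enumerations and a bijection avoiding given values *)

Section Enumeration.
Variable T : finType.

Lemma card3_uniq (S : {set T}) : #|S| = 3 ->
  exists x y z, uniq [:: x; y; z] /\ S =i [:: x; y; z].
Proof.
rewrite cardE => szS; have := mem_enum S; have := enum_uniq S.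
case: (enum S) szS => [|x [|y [|z []]]] // _ u S_def; by exists x, y, z; split.
Qed.

Lemma uniq_card3 x y z : uniq [:: x; y; z] -> #|[set v : T in [:: x; y; z]]| = 3.
Proof. by move=> u; rewrite cardsE (card_uniqP u). Qed.

Lemma third_point x y : x != y -> 3 <= #|T| -> exists z : T, uniq [:: x; y; z].
Proof.
move=> nxy T3; have /set0Pn[z] : ~: [set x; y] != set0.
  by rewrite -card_gt0 cardsCs setCK cards2 nxy subn_gt0.
rewrite !inE negb_or => /andP[zx zy]; exists z.
by rewrite /= !inE negb_or nxy eq_sym zx eq_sym zy.
Qed.

(** List [a], then the values of [f] in order, then everything else. *)
Lemma enumeration_extending (m : nat) (a : T) (f : 'I_m -> T) :
  injective f -> (forall i, f i != a) -> exists s : seq T,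
  [/\ uniq s, s =i T, index a s = 0 & forall i, index (f i) s = i.+1].
Proof.
move=> f_inj fa; pose r := [seq v <- enum T | v \notin a :: codom f].
exists (a :: codom f ++ r); split=> [|v||i].
- rewrite /= mem_cat negb_or mem_filter mem_head /= andbT cat_uniq.
  rewrite filter_uniq ?enum_uniq // map_inj_uniq // enum_uniq andbT /=.
  apply/andP; split; first by apply/codomP => -[i ai]; have := fa i; rewrite -ai eqxx.
  by apply/hasPn => v; rewrite mem_filter inE negb_or -andbA => /and3P[].
- rewrite -cat_cons mem_cat mem_filter mem_enum andbT inE.
  by rewrite orbN.
- by rewrite /= eqxx.
rewrite /= eq_sym (negPf (fa i)) index_cat codom_f /codom /image_mem.
by rewrite index_map // index_enum_ord.
Qed.

(* Shifting one enumeration cyclically, except at its head, against the other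
   is a derangement off the head since there are at least two other places. *)
Lemma twisted_bijection (m : nat) (a b : T) (f g : 'I_m -> T) : 3 <= #|T| ->
  injective f -> (forall i, f i != a) -> injective g -> (forall i, g i != b) ->
  exists p : T -> T, [/\ injective p, p b = a & forall i, p (g i) != f i].
Proof.
move=> T3 f_inj fa g_inj gb.
have [s [s_uniq sT sa sf]] := enumeration_extending f_inj fa.
have [r [r_uniq rT rb rg]] := enumeration_extending g_inj gb.
have szs : size s = #|T| by rewrite -(card_uniqP s_uniq); apply: eq_card.
have szr : size r = #|T| by rewrite -(card_uniqP r_uniq); apply: eq_card.
(* Place 0 is fixed, which sends [b] to [a]; places 1 to [#|T|] - 1 are cycled. *)
pose shift j := if j == 0 then 0 else if j.+1 < #|T| then j.+1 else 1.
have shift_lt j : shift j < size s.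
  by rewrite /shift szs; do 2?case: ifP => // _; rewrite (leq_trans _ T3).
have idx v : index v r < #|T| by rewrite -szr index_mem rT.
exists (fun v => nth a s (shift (index v r))); split=> [u v /eqP||i].
- rewrite nth_uniq // => /eqP eq_uv; suff eq_i : index u r = index v r.
    by rewrite -(nth_index a (etrans (rT u) isT)) eq_i nth_index ?rT.
  move: eq_uv (idx u) (idx v); rewrite /shift.
  case: (index u r) (index v r) => [|j] [|l] //=; first by case: ifP.
    by case: ifP.
  case: ltnP => jT; case: ltnP => lT // eq_jl jN lN; first by case: eq_jl => ->.
  by apply/eqP; rewrite eqn_leq -ltnS (leq_trans jN lT) -ltnS (leq_trans lN jT).
- by rewrite rb -[RHS](nth_index a (etrans (sT a) isT)) sa.
rewrite -[f i](nth_index a (etrans (sT _) isT)) nth_uniq ?index_mem ?sT //.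
rewrite sf rg /shift /=; case: ltnP => [_|]; first by rewrite -[_ == _]/(i.+1 == i) gtn_eqF.
(* On wrapping round to place 1, equality would force [i] = 0 and hence [#|T|] at most 2. *)
by apply: contraL => /eqP[<-]; rewrite -ltnNge.
Qed.

Definition preimage_of (I : finType) (f : I -> T) (v : T) : option I := [pick i | f i == v].

Lemma preimage_ofK (I : finType) (f : I -> T) : injective f -> pcancel f (preimage_of f).
Proof.
move=> f_inj i; rewrite /preimage_of; case: pickP => [j /eqP/f_inj -> //|/(_ i)].
by rewrite eqxx.
Qed.

End Enumeration.

(** * Distributing links and fibre edges *)

Definition fibre_rel (T1 T2 : finType) (h : rel T2) : rel (T1 * T2) :=
  fun p q => (p.1 == q.1) && h p.2 q.2.

Section Assembly.
Variables (T1 T2 : finType) (h : rel T2) (m : nat).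
Implicit Types (F : {set {set T1}}) (S : {set T1 * T2}) (P : T2 + 'I_m -> {set {set T1 * T2}}).

(** This separates fibre edges from blow-up edges, whose projections have two elements. *)
Lemma fibre_edges_fst e : e \in edges (@fibre_rel T1 T2 h) -> #|fst @: e| < 2.
Proof.
case/edgesP=> p [q [/andP[/eqP eq_pq _] ->]].
by rewrite imset_fst_pair eq_pq setUid cards1.
Qed.

Lemma conn_fibre (u : T1) (E : {set {set T2}}) a b : conn E a b ->
  conn [set pair u @: (e : {set T2}) | e in E] (u, a) (u, b).
Proof.
case/connectP=> p + ->; elim: p a => [|c p IH] a /= => [_|/andP[acE /IH]].
  exact: connect0.
by apply: conn_trans; apply: conn1; apply/imsetP; exists [set a; c]; rewrite // imsetU1 imset_set1.
Qed.

Lemma assemble F w (L : T1 -> {set {set T1}}) (D : T1 -> 'I_m -> {set {set T2}})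
    (own : T1 -> T2 -> T2 -> option (T2 + 'I_m)) :
  (forall e, e \in F -> #|e| = 2) -> (forall u, L u \subset F) -> disjoint_family L ->
  (forall u i, D u i \subset edges h) -> (forall u, disjoint_family (D u)) ->
  exists P, [/\ disjoint_family P,
    forall t, P (inl t) \subset blowup T2 F,
    forall i, P (inr i) \subset blowup T2 F :|: edges (@fibre_rel T1 T2 h),
    forall u s t k, u != w -> conn (L u) w u -> own u s t = Some k ->
      conn (P k) (u, s) (w, t)
  & forall u i a b, conn (D u i) a b -> conn (P (inr i)) (u, a) (u, b)].
Proof.
move=> F2 LF Ldis Dh Ddis.
have /fin_all_exists[Q Q_def] u : exists Q : T2 -> T2 -> {set {set T1 * T2}},
    [/\ u != w -> conn (L u) w u -> forall s t, conn (Q s t) (u, s) (w, t),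
        forall s t, Q s t \subset blowup T2 (L u)
      & forall i j i' j' e, e \in Q i j -> e \in Q i' j' -> i = i' /\ j = j'].
  case: (boolP ((u != w) && conn (L u) u w)) => [/andP[nuw cuw]|].
    by have [Q [Qc Qs Qd]] := links T2 cuw nuw; exists Q.
  rewrite negb_and => /orP not_uw.
  (* Where no leg leads from [w] to [u], all links are empty. *)
  exists (fun _ _ => set0); split=> [nuw|s t|? ? ? ? e]; rewrite ?sub0set ?inE //.
  by rewrite conn_sym => cuw; case: not_uw => /negP[].
pose C i : {set {set T1 * T2}} := \bigcup_u [set pair u @: (e : {set T2}) | e in D u i].
pose R k : {set {set T1 * T2}} :=
  \bigcup_(q : T1 * T2 * T2 | own q.1.1 q.1.2 q.2 == Some k) Q q.1.1 q.1.2 q.2.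
have RP k e : e \in R k -> exists u s t, own u s t = Some k /\ e \in Q u s t.
  by case/bigcupP=> -[[u s] t] /eqP /= o eQ; exists u, s, t.
have CP i e : e \in C i -> exists u e', e' \in D u i /\ e = pair u @: e'.
  by case/bigcupP=> u _ /imsetP[e' e'D ->]; exists u, e'.
have blowS u : blowup T2 (L u) \subset blowup T2 F.
  by apply/subsetP => e; rewrite !inE => /andP[-> /(subsetP (LF u))].
have RF k : R k \subset blowup T2 F.
  apply/subsetP => e /RP[u [s [t [_ eQ]]]]; apply: (subsetP (blowS u)).
  by have [_ Qs _] := Q_def u; apply: subsetP (Qs s t) _ eQ.
have Ch i : C i \subset edges (@fibre_rel T1 T2 h).
  apply/subsetP => e /CP[u [e' [/(subsetP (Dh u i))/edgesP[a [b [hab ->]]] ->]]].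
  apply/edgesP; exists (u, a), (u, b); split; first by rewrite /fibre_rel eqxx.
  by rewrite imsetU1 imset_set1.
have RC k i e : e \in R k -> e \in C i -> False.
  move=> /(subsetP (RF k)); rewrite inE => /andP[_ /F2 e2] /(subsetP (Ch i))/fibre_edges_fst.
  by rewrite e2.
have Rdis : disjoint_family R.
  move=> k l e /RP[u [s [t [o eQ]]]] /RP[u' [s' [t' [o' eQ']]]].
  have eL v a b : e \in Q v a b -> fst @: e \in L v.
    have [_ Qs _] := Q_def v; move/(subsetP (Qs _ _)); rewrite inE.
    by case/andP.
  (* Disjoint legs determine [u] from the edge; disjoint links then determine [s] and [t], hence the
     owner. *)
  have eq_u := Ldis _ _ _ (eL _ _ _ eQ) (eL _ _ _ eQ'); rewrite -eq_u in o' eQ'.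
  have [_ _ Qd] := Q_def u; have [eq_s eq_t] := Qd _ _ _ _ _ eQ eQ'.
  by move: o'; rewrite -eq_s -eq_t o => -[].
have Cdis : disjoint_family C.
  move=> i j e /CP[u [e1 [e1D ->]]] /CP[v [e2 [e2D eq_e]]].
  have /edgesP[a [b [_ e1_def]]] := subsetP (Dh u i) _ e1D.
  have : (u, a) \in pair v @: e2 by rewrite -eq_e imset_f // e1_def !inE eqxx.
  case/imsetP=> _ _ [eq_uv _]; rewrite -eq_uv in eq_e e2D.
  have eq12 : e1 = e2 by apply: imset_inj eq_e => x y [].
  by apply: Ddis e1D _; rewrite eq12.
exists (fun k => R k :|: (if k is inr i then C i else set0)); split.
- move=> k l e /setUP[eR|eC] /setUP[eR'|eC'].
  + exact: Rdis eR eR'.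
  + by case: l eC' => [t|i]; rewrite ?inE // => /(RC _ _ _ eR).
  + by case: k eC => [t|i]; rewrite ?inE // => /(RC _ _ _ eR').
  by case: k l eC eC' => [t|i] [t'|j]; rewrite ?inE // => /Cdis eC /eC ->.
- by move=> t; rewrite setU0.
- by move=> i; apply: setUSS.
- move=> u s t k nuw cuw o; have [Qc _ _] := Q_def u.
  apply: connS (Qc nuw cuw s t); apply/subsetP => e eQ; rewrite inE; apply/orP; left.
  by apply/bigcupP; exists (u, s, t) => //=; rewrite o.
move=> u i a b /(conn_fibre u); apply: connS; apply: subset_trans (subsetUr _ _).
exact: (bigcup_sup u).
Qed.

End Assembly.

(** * Packings from one tree of G, by the position of S *)

Section Cases.
Variables (T1 T2 : finType) (h : rel T2) (m : nat).
Hypothesis T2_3 : 3 <= #|T2|.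
Hypothesis packs_h : forall S : {set T2}, #|S| = 3 -> packs h S 'I_m.
Implicit Types (F : {set {set T1}}) (S : {set T1 * T2}) (P : T2 + 'I_m -> {set {set T1 * T2}}).

(* The trees [inl t] stay in the blow-up, so that they can be produced once for
   each of several disjoint F; the trees [inr i] also use the copies of H. *)
Definition good_packing F S P : Prop :=
  [/\ disjoint_family P,
      forall t, P (inl t) \subset blowup T2 F,
      forall i, P (inr i) \subset blowup T2 F :|: edges (@fibre_rel T1 T2 h)
    & forall k, connects (P k) S].

(** Complete [c] to a triple: the [m] disjoint sets connecting it leave [c] towards distinct
    neighbours. *)
Lemma packs_h_neighbours (c : T2) : exists (D : 'I_m -> {set {set T2}}) (nb : 'I_m -> T2),
  [/\ forall i, D i \subset edges h, disjoint_family D,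
      injective nb, forall i, nb i != c & forall i, conn (D i) c (nb i)].
Proof.
have [|S cS S3] := @exists_superset T2 [set c] 3; first by rewrite cards1 T2_3.
have [D [Dh Ddis Dcon]] := packs_h S3.
have S2 : 1 < #|S| by rewrite S3.
have cS' : c \in S by rewrite -sub1set.
have [nb nbc nbD] := fin_all_exists2 (packing_neighbours Dcon Ddis S2 cS').
exists D, nb; split=> // [i j eq_ij|i]; last exact: conn1.
by apply: (Ddis _ _ _ (nbD i)); rewrite eq_ij.
Qed.

Lemma packs_h_triple (a b c : T2) : uniq [:: a; b; c] -> exists D : 'I_m -> {set {set T2}},
  [/\ forall i, D i \subset edges h, disjoint_family D,
      forall i, conn (D i) a b & forall i, conn (D i) a c].
Proof.
move=> /uniq_card3/packs_h[D [Dh Ddis Dcon]]; exists D.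
by split=> // i; apply: Dcon; rewrite !inE eqxx ?orbT.
Qed.

Lemma connects_in (E : {set {set T1 * T2}}) S (s : seq (T1 * T2)) p :
  S =i s -> {in s, forall q, conn E q p} -> connects E S.
Proof.
by move=> eqS hub; apply: (@connects_hub _ _ _ p) => q; rewrite eqS conn_sym; apply: hub.
Qed.

(** Three fibres. The sets [inl t] own all links at the vertices [(u, al u)] with [u] distinct from
    [w], so in such a fibre an extra set first moves to the neighbour [nb u i] and takes a link from
    there. *)
Lemma good_packing_spread F S (x y z : T1) (a b c : T2) :
  (forall e, e \in F -> #|e| = 2) -> uniq [:: x; y; z] -> conn F x y -> conn F x z ->
  S =i [:: (x, a); (y, b); (z, c)] -> exists P, good_packing F S P.
Proof.
move=> F2 uniq_xyz xy xz S_def.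
have [w [L [Lcon LF Ldis]]] := tripod F2 uniq_xyz xy xz.
(* The height of the vertex of [S] above [u]; vertices other than [x], [y], [z] get the default
   [c]. *)
pose al u := if u == x then a else if u == y then b else c.
have S_al p : p \in S -> p.1 \in [:: x; y; z] /\ p = (p.1, al p.1).
  move: uniq_xyz; rewrite /= !inE negb_or => /and3P[/andP[nxy nxz] nyz _].
  rewrite S_def !inE => /or3P[] /eqP-> /=; rewrite /al ?eqxx ?orbT //.
    by rewrite eq_sym (negPf nxy).
  by rewrite eq_sym (negPf nxz) eq_sym (negPf nyz).
have /fin_all_exists[D /fin_all_exists[nb D_def]] := fun u => packs_h_neighbours (al u).
have Dh u : forall i, D u i \subset edges h by case: (D_def u).
have Ddis u : disjoint_family (D u) by case: (D_def u).
have nb_inj u : injective (nb u) by case: (D_def u).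
have nb_al u i : nb u i != al u by case: (D_def u).
have Dcon u i : conn (D u i) (al u) (nb u i) by case: (D_def u).
have [w_in|w_out] := boolP (w \in [:: x; y; z]).
- (* The detours (u, al u) - (w, t) - (u, p u t) - (w, al w) give the n trees;
     p avoids the links (u, nb u i) - (w, nb w i), left to the extra ones. *)
  have /fin_all_exists[p p_def] u := twisted_bijection T2_3 (nb_inj u) (nb_al u) (nb_inj w) (nb_al w).
  have p_inj u : injective (p u) by case: (p_def u).
  have p_al u : p u (al w) = al u by case: (p_def u).
  have p_nb u i : p u (nb w i) != nb u i by case: (p_def u).
  pose own u s t : option (T2 + 'I_m) :=
    if s == al u then Some (inl t)
    else if t == al w then omap inl (preimage_of (p u) s)
    else if s == p u t then Some (inl t)
    else omap inr (preimage_of (nb u) s).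
  have [P [Pdis PF PFh Pl Ph]] := assemble w own F2 LF Ldis Dh Ddis.
  exists P; split=> // k; apply: (@connects_hub _ _ _ (w, al w)) => q /S_al[qX ->].
  have [->|nqw] := eqVneq q.1 w; first exact: connect0.
  move: (q.1) qX nqw => u uX nuw; rewrite conn_sym.
  have {}Pl s t l := Pl u s t l nuw (Lcon u uX).
  case: k => [t|i]; last first.
    apply: conn_trans (Ph _ _ _ _ (Dcon u i)) _.
    apply: (@conn_trans _ _ (w, nb w i)); last by rewrite conn_sym; apply/Ph/Dcon.
    apply: Pl; rewrite /own (negPf (nb_al _ _)) (negPf (nb_al _ _)) eq_sym (negPf (p_nb _ _)).
    by rewrite preimage_ofK.
  apply: (@conn_trans _ _ (w, t)); first by apply: Pl; rewrite /own eqxx.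
  apply: (@conn_trans _ _ (u, p u t)).
    rewrite conn_sym; apply: Pl; rewrite /own eqxx; case: ifP => // _.
    by case: ifP => // _; rewrite preimage_ofK.
  (* If [p u t] is [al u], the first clause of [own] decides; then [t] is [al w], so the owner
     agrees. *)
  apply: Pl; rewrite /own eqxx preimage_ofK //; case: eqP => // eq_p.
  by congr (Some (inl _)); apply: (p_inj u); rewrite p_al.
(* With the hub outside the three fibres, all extra sets can meet at [(w, a)], each arriving from
   its own neighbours. *)
pose own u s t : option (T2 + 'I_m) :=
  if s == al u then Some (inl t)
  else if t == a then omap inr (preimage_of (nb u) s) else None.
have [P [Pdis PF PFh Pl Ph]] := assemble w own F2 LF Ldis Dh Ddis.
exists P; split=> // k.
apply: (@connects_hub _ _ _ (w, if k is inl t then t else a)) => q /S_al[qX ->].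
have nqw : q.1 != w by apply: contraNneq w_out => <-.
move: (q.1) qX nqw => u uX nuw; rewrite conn_sym.
have {}Pl s t l := Pl u s t l nuw (Lcon u uX).
case: k => [t|i]; first by apply: Pl; rewrite /own eqxx.
apply: conn_trans (Ph _ _ _ _ (Dcon u i)) _.
by apply: Pl; rewrite /own (negPf (nb_al _ _)) eqxx preimage_ofK.
Qed.

(** The vertex [y] only completes the tripod. An extra set joins [a], [b] and a third point [d] by a
    copy of H in the fibre of [x], and goes from [(x, d)] to [(z, nb i)], a neighbour of [(z, c)] in
    its fibre. *)
Lemma good_packing_two_fibres F S (x y z : T1) (a b c : T2) :
  (forall e, e \in F -> #|e| = 2) -> uniq [:: x; y; z] -> conn F x y -> conn F x z ->
  a != b -> S =i [:: (x, a); (x, b); (z, c)] -> exists P, good_packing F S P.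
Proof.
move=> F2 uniq_xyz xy xz nab S_def.
have [w [L [Lcon LF Ldis]]] := tripod F2 uniq_xyz xy xz.
have [d uniq_abd] := third_point nab T2_3.
have [Dx [Dxh Dxdis Dxab Dxad]] := packs_h_triple uniq_abd.
have [Dz [nb [Dzh Dzdis nb_inj nbc Dzcon]]] := packs_h_neighbours c.
pose D u := if u == x then Dx else Dz.
have Dh u i : D u i \subset edges h by rewrite /D; case: ifP.
have Ddis u : disjoint_family (D u) by rewrite /D; case: ifP.
have Lx : conn (L x) w x by apply: Lcon; rewrite !inE eqxx.
have Ly : conn (L y) w y by apply: Lcon; rewrite !inE eqxx orbT.
have Lz : conn (L z) w z by apply: Lcon; rewrite !inE eqxx !orbT.
move: uniq_xyz uniq_abd; rewrite /= !inE !negb_or.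
move=> /and3P[/andP[nxy nxz] nyz _] /and3P[/andP[_ nad] nbd _].
have nyx : y != x by rewrite eq_sym.
have nzx : z != x by rewrite eq_sym.
have nzy : z != y by rewrite eq_sym.
have nda : d != a by rewrite eq_sym.
have ndb : d != b by rewrite eq_sym.
have hub (P : T2 + 'I_m -> {set {set T1 * T2}}) :
    (forall u i a b, conn (D u i) a b -> conn (P (inr i)) (u, a) (u, b)) ->
    (forall t, exists p, [/\ conn (P (inl t)) (x, a) p, conn (P (inl t)) (x, b) p
       & conn (P (inl t)) (z, c) p]) ->
    (forall i, conn (P (inr i)) (x, d) (z, nb i)) ->
    forall k, connects (P k) S.
  move=> Ph Pt Pi [t|i].
    have [p [pa pb pc]] := Pt t; apply: (@connects_in _ S _ p S_def) => q.
    by rewrite !inE => /or3P[] /eqP->.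
  have xa b' : conn (Dx i) a b' -> conn (P (inr i)) (x, a) (x, b').
    by move=> ab'; apply: Ph; rewrite /D eqxx.
  apply: (@connects_in _ S _ (x, a) S_def) => q.
  rewrite !inE => /or3P[] /eqP->; first exact: connect0.
    by rewrite conn_sym xa.
  apply: (@conn_trans _ _ (z, nb i)); first by apply: Ph; rewrite /D (negPf nzx).
  by rewrite conn_sym; apply: conn_trans (Pi i); rewrite xa.
have [eq_w|nxw] := eqVneq x w.
(* Hub [x]: the star from [(y, t)] to the fibre of [x] joins [(x, a)], [(x, b)] and [(x, t)], and
   [(x, t)] is linked to [(z, c)]. *)
- pose own u s t : option (T2 + 'I_m) :=
    if u == z then if s == c then Some (inl t)
                   else if t == d then omap inr (preimage_of nb s) else None
    else Some (inl s).
  have [P [Pdis PF PFh Pl Ph]] := assemble w own F2 LF Ldis Dh Ddis.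
  rewrite -eq_w in Ly Lz Pl.
  exists P; split=> //; apply: hub => // [t|i].
    have yt s : conn (P (inl t)) (y, t) (x, s) by apply: Pl => //; rewrite /own (negPf nyz).
    exists (x, t); split; first by apply: conn_trans (yt t); rewrite conn_sym yt.
      by apply: conn_trans (yt t); rewrite conn_sym yt.
    by apply: Pl => //; rewrite /own !eqxx.
  by rewrite conn_sym; apply: Pl => //; rewrite /own !eqxx (negPf (nbc i)) preimage_ofK.
have [eq_w|nzw] := eqVneq z w.
(* Hub [z]: [(x, a)] and [(x, b)] are linked to [(z, t)], which the star at [(y, t)] joins to
   [(z, c)]. *)
- pose own u s t : option (T2 + 'I_m) :=
    if u == x then if s == d then omap inr (preimage_of nb t) else Some (inl t)
    else Some (inl s).
  have [P [Pdis PF PFh Pl Ph]] := assemble w own F2 LF Ldis Dh Ddis.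
  rewrite -eq_w in Ly Lx Pl.
  exists P; split=> //; apply: hub => // [t|i].
    have yt s : conn (P (inl t)) (y, t) (z, s) by apply: Pl => //; rewrite /own (negPf nyx).
    exists (z, t); split.
    + by apply: Pl => //; rewrite /own eqxx (negPf nad).
    + by apply: Pl => //; rewrite /own eqxx (negPf nbd).
    by apply: conn_trans (yt t); rewrite conn_sym yt.
  by apply: Pl => //; rewrite /own !eqxx preimage_ofK.
(* Hub elsewhere: the sets meet in its fibre, at [(w, t)] for [inl t] and at [(w, nb i)] for
   [inr i]. *)
pose own u s t : option (T2 + 'I_m) :=
  if u == x then if s == d then omap inr (preimage_of nb t) else Some (inl t)
  else if s == c then Some (inl t) else omap inr (preimage_of nb s).
have [P [Pdis PF PFh Pl Ph]] := assemble w own F2 LF Ldis Dh Ddis.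
exists P; split=> //; apply: hub => // [t|i].
  exists (w, t); split.
  - by apply: Pl => //; rewrite /own eqxx (negPf nad).
  - by apply: Pl => //; rewrite /own eqxx (negPf nbd).
  by apply: Pl => //; rewrite /own (negPf nzx) eqxx.
apply: (@conn_trans _ _ (w, nb i)).
  by apply: Pl => //; rewrite /own !eqxx preimage_ofK.
by rewrite conn_sym; apply: Pl => //; rewrite /own (negPf nzx) (negPf (nbc i)) preimage_ofK.
Qed.

(** Stars centred at the points [(y, t)] give the sets [inl t]; the extra sets stay in the fibre of
    [x]. The whole of [F] serves as a single leg. *)
Lemma good_packing_one_fibre F S (x y : T1) (a b c : T2) :
  (forall e, e \in F -> #|e| = 2) -> x != y -> conn F x y ->
  uniq [:: a; b; c] -> S =i [:: (x, a); (x, b); (x, c)] -> exists P, good_packing F S P.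
Proof.
move=> F2 nxy xy uniq_abc S_def.
have [D [Dh Ddis Dab Dac]] := packs_h_triple uniq_abc.
pose L u := if u == y then F else set0.
have LF u : L u \subset F by rewrite /L; case: ifP; rewrite ?sub0set.
have Ldis : disjoint_family L.
  by move=> u v e; rewrite /L; do 2![case: eqP => [->|_]]; rewrite ?inE.
pose own (u : T1) (s t : T2) : option (T2 + 'I_m) := Some (inl s).
have [P [Pdis PF PFh Pl Ph]] :=
  @assemble T1 T2 h m F x L (fun=> D) own F2 LF Ldis (fun=> Dh) (fun=> Ddis).
exists P; split=> // -[t|i].
  apply: (@connects_in _ S _ (y, t) S_def) => q qS; rewrite conn_sym.
  have -> : q = (x, q.2) by move: qS; rewrite !inE => /or3P[] /eqP->.
  by apply: Pl; rewrite // 1?eq_sym // /L eqxx.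
apply: (@connects_in _ S _ (x, a) S_def) => q.
rewrite !inE => /or3P[] /eqP->; first exact: connect0.
  by rewrite conn_sym; apply: Ph.
by rewrite conn_sym; apply: Ph.
Qed.

(** If the projection of [S] has fewer than three points, [X] supplies the auxiliary vertex. *)
Lemma good_packing_exists F (X : {set T1}) S :
  (forall e, e \in F -> #|e| = 2) -> #|X| = 3 -> #|S| = 3 ->
  {in S, forall p, p.1 \in X} -> connects F X -> exists P, good_packing F S P.
Proof.
move=> F2 X3 S3 SX con.
have other x z : x \in X -> z \in X -> x != z ->
    exists2 y, uniq [:: x; y; z] & y \in X.
  move=> xX zX nxz; have : 0 < #|X :\ x :\ z|.
    by move: X3; rewrite (cardsD1 x) xX (cardsD1 z) inE zX inE eq_sym nxz; case: #|_|.
  case/card_gt0P=> y; rewrite !inE => /and3P[nyz nyx yX]; exists y => //.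
  by rewrite /= !inE negb_or nyz eq_sym nyx nxz.
have two (p q r : T1 * T2) : uniq [:: p; q; r] -> S =i [:: p; q; r] ->
    p.1 = q.1 -> p.1 != r.1 -> exists P, good_packing F S P.
  case: p q r => [x a] [x' b] [z c] /= u S_def eq_x nxz; rewrite -{x'}eq_x in u S_def.
  have xX : x \in X by apply: (SX (x, a)); rewrite S_def !inE eqxx.
  have zX : z \in X by apply: (SX (z, c)); rewrite S_def !inE eqxx !orbT.
  have [y uy yX] := other _ _ xX zX nxz.
  apply: (good_packing_two_fibres F2 uy (con _ _ xX yX) (con _ _ xX zX) _ S_def).
  by apply: contraTneq u => ->; rewrite /= inE eqxx.
have [p [q [r [u S_def]]]] := card3_uniq S3.
have [eq_pq|npq] := eqVneq p.1 q.1; have [eq_pr|npr] := eqVneq p.1 r.1.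
- case: p q r eq_pq eq_pr u S_def => [x a] [x' b] [x'' c] /= <- <- u S_def.
  have xX : x \in X by apply: (SX (x, a)); rewrite S_def !inE eqxx.
  have : 0 < #|X :\ x| by move: X3; rewrite (cardsD1 x) xX; case: #|_|.
  case/card_gt0P=> y; rewrite !inE => /andP[nyx yX].
  apply: (good_packing_one_fibre F2 _ (con _ _ xX yX) _ S_def); first by rewrite eq_sym.
  by move: u; rewrite /= !inE !xpair_eqE !eqxx.
- exact: two u S_def eq_pq npr.
- apply: (two p r q) => //; last 1 first.
    by move=> v; rewrite S_def !inE; congr (_ || _); rewrite orbC.
  by move: u; rewrite /= !inE !negb_or [r == q]eq_sym => /and3P[/andP[-> ->] -> _].
have [eq_qr|nqr] := eqVneq q.1 r.1.
  apply: (two q r p) => //; last 1 first.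
  - by rewrite eq_sym.
  - by move: u; rewrite /= !inE !negb_or [q == p]eq_sym [r == p]eq_sym => /and3P[/andP[-> ->] -> _].
  by move=> v; rewrite S_def !inE orbC orbA.
have pX : p.1 \in X by apply: SX; rewrite S_def !inE eqxx.
have qX : q.1 \in X by apply: SX; rewrite S_def !inE eqxx orbT.
have rX : r.1 \in X by apply: SX; rewrite S_def !inE eqxx !orbT.
apply: (@good_packing_spread F S p.1 q.1 r.1 p.2 q.2 r.2 F2 _ (con _ _ pX qX) (con _ _ pX rX)).
  by rewrite /= !inE negb_or npq npr nqr.
by rewrite -!surjective_pairing.
Qed.

End Cases.

(** * The lower bound for the lexicographic product *)

Lemma edges_card2 (T : finType) (g : rel T) e : irreflexive g -> e \in edges g -> #|e| = 2.
Proof.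
move=> girr /edgesP[x [y [gxy ->]]]; rewrite cards2.
by case: eqVneq gxy => // ->; rewrite girr.
Qed.

Section Product.
Variables (T1 T2 : finType) (g : rel T1) (h : rel T2).
Hypotheses (gS : simple_graph g) (hS : simple_graph h).
Hypotheses (T1_3 : 3 <= #|T1|) (T2_3 : 3 <= #|T2|) (cg : connected_graph g).

Lemma lexprod_sym : symmetric (lexprod g h).
Proof.
have [[gsym _] [hsym _]] := (gS, hS).
by move=> p q; rewrite /lexprod gsym hsym eq_sym.
Qed.

Lemma blowup_lexprod (F : {set {set T1}}) :
  F \subset edges g -> blowup T2 F \subset edges (lexprod g h).
Proof.
have [gsym girr] := gS; move=> /subsetP Fg; apply/subsetP => e.
rewrite inE => /andP[/cards2P[p [q [_ ->]]]]; rewrite imset_fst_pair => /Fg pqg.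
apply/edgesP; exists p, q; rewrite /lexprod (edges_pair gsym _ pqg) //.
by have := edges_card2 girr pqg; rewrite cards2 eq_sym; case: (q.1 == p.1).
Qed.

Lemma fibre_lexprod : edges (@fibre_rel T1 T2 h) \subset edges (lexprod g h).
Proof.
apply/subsetP => e /edgesP[p [q [pq ->]]]; apply/edgesP; exists p, q.
by rewrite /lexprod -[_ && _]/(fibre_rel h p q) pq orbT.
Qed.

(** Blow-ups of disjoint trees are disjoint, so each tree contributes its sets [inl t]. The copies
    of H exist only once, so the sets [inr i] are taken from the single tree [k0]. *)
Lemma lexprod_packs (S : {set T1 * T2}) : #|S| = 3 ->
  packs (lexprod g h) S ('I_(lambda_k g 3) * T2 + 'I_(lambda_k h 3)).
Proof.
move=> S3; have [_ girr] := gS.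
have [|X SX X3] := @exists_superset T1 (fst @: S) 3.
  by rewrite T1_3 andbT -S3 leq_imset_card.
have [F [Fg Fdis Fcon]] := lambda_k_packs g X3.
have F2 k e : e \in F k -> #|e| = 2.
  by move/(subsetP (Fg k)); apply: edges_card2.
have SX' : {in S, forall p, p.1 \in X}.
  by move=> p pS; apply: (subsetP SX); apply: imset_f.
have [P P_def] := fin_all_exists (fun k =>
  good_packing_exists T2_3 (@lambda_k_packs T2 h 3) (F2 k) X3 S3 SX' (Fcon k)).
have Pdis k : disjoint_family (P k) by case: (P_def k).
have Pl k t : P k (inl t) \subset blowup T2 (F k) by case: (P_def k).
have Pr k i : P k (inr i) \subset blowup T2 (F k) :|: edges (@fibre_rel T1 T2 h).
  by case: (P_def k).
have Pcon k j : connects (P k j) S by case: (P_def k).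
have T1_range : 1 < 3 <= #|T1| by [].
pose k0 := Ordinal (lambda_k_gt0 T1_range cg).
have blow_dis k l e : e \in blowup T2 (F k) -> e \in blowup T2 (F l) -> k = l.
  by rewrite !inE => /andP[_ ek] /andP[_ el]; apply: Fdis ek el.
have lr k t i e : e \in P k (inl t) -> e \in P k0 (inr i) -> False.
  move=> ek e0; have ekF := subsetP (Pl k t) _ ek.
  have /setUP[e0F|/fibre_edges_fst] := subsetP (Pr k0 i) _ e0.
    have eq_k := blow_dis _ _ _ ekF e0F; rewrite eq_k in ek.
    by have := Pdis _ _ _ _ ek e0.
  by move: ekF; rewrite inE => /andP[_ /F2 ->].
exists (fun j => match j with inl kt => P kt.1 (inl kt.2) | inr i => P k0 (inr i) end).
split=> [[[k t]|i]|j j' e|[[k t]|i]] //=.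
- exact: subset_trans (Pl k t) (blowup_lexprod (Fg k)).
- apply: subset_trans (Pr k0 i) _.
  by rewrite subUset blowup_lexprod // fibre_lexprod.
case: j j' => [[k t]|i] [[l s]|i'] /= ej ej'.
- have eq_kl := blow_dis _ _ _ (subsetP (Pl k t) _ ej) (subsetP (Pl l s) _ ej').
  by rewrite -eq_kl in ej' *; have [->] := Pdis _ _ _ _ ej ej'.
- by case: (lr _ _ _ _ ej ej').
- by case: (lr _ _ _ _ ej' ej).
by have [->] := Pdis _ _ _ _ ej ej'.
Qed.

Lemma lexprod_lower_bound :
  lambda_k h 3 + lambda_k g 3 * #|T2| <= lambda_k (lexprod g h) 3.
Proof.
have T12_3 : 3 <= #|{: T1 * T2}|.
  by rewrite card_prod (leq_trans T1_3) // leq_pmulr // (leq_trans _ T2_3).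
have -> : lambda_k h 3 + lambda_k g 3 * #|T2| =
    #|{: 'I_(lambda_k g 3) * T2 + 'I_(lambda_k h 3)}|.
  by rewrite card_sum card_prod !card_ord addnC.
apply: packs_lambda_k => //; last exact: lexprod_packs.
(* The product is connected because any two vertices lie in a triple, which every member of a
   packing connects. *)
apply: connected_graph_edges lexprod_sym _ => p q.
have [|S pqS S3] := @exists_superset (T1 * T2)%type [set p; q] 3.
  by rewrite T12_3 andbT cards2; case: eqP.
have [P [Pg _ Pcon]] := lexprod_packs S3.
have T1_range : 1 < 3 <= #|T1| by [].
have t : T2 by have /card_gt0P/sigW[t _] := ltnW (ltnW T2_3).
move: pqS; rewrite subUset !sub1set => /andP[pS qS].
exact: connS (Pg _) (Pcon (inl (Ordinal (lambda_k_gt0 T1_range cg), t)) _ _ pS qS).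
Qed.

End Product.

(** * Sharpness *)

(* The centre of the path is [None]. *)
Definition path3 : rel (option bool) := fun p q => isSome p (+) isSome q.
Definition empty3 : rel 'I_3 := fun _ _ => false.

Lemma path3_connected : connected_graph path3.
Proof.
have to_centre p : connect path3 p None by case: p => [b|]; [exact: connect1 | exact: connect0].
apply/forallP => p; apply/forallP => q; apply: connect_trans (to_centre p) _.
by case: q => [b|]; [exact: connect1 | exact: connect0].
Qed.

Lemma lambda_empty3 : lambda_k empty3 3 = 0.
Proof.
rewrite /lambda_k ifF //; apply/negP => /connected_graph_conn/(_ ord0 ord_max).
by case/conn_first_edge=> // z _ /edgesP[x [y []]].
Qed.

Lemma lambda_path3_empty3 : lambda_k (lexprod path3 empty3) 3 <= 3.
Proof.
pose leaf : option bool * 'I_3 := (Some true, ord0).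
have [|S leafS S3] := @exists_superset _ [set leaf] 3.
  by rewrite cards1 card_prod card_option card_bool card_ord.
rewrite sub1set in leafS; rewrite -[leqLHS]card_ord.
apply: leq_trans (packs_degree _ _ leafS (lambda_k_packs _ S3)) _.
- by case=> p i [q j]; rewrite /lexprod /= !andbF !orbF /path3 addbC.
- by rewrite S3.
rewrite -[leqRHS](card_ord 3) -cardsT.
apply: leq_trans (leq_imset_card (pair None) _); apply/subset_leq_card/subsetP.
by case=> -[b|] j; rewrite inE /lexprod /= ?andbF //= => _; apply: imset_f.
Qed.

Theorem theorem1 :
  (forall (T1 T2 : finType) (g : rel T1) (h : rel T2),
      simple_graph g -> simple_graph h ->
      3 <= #|T1| -> 3 <= #|T2| -> connected_graph g ->
      lambda_k h 3 + lambda_k g 3 * #|T2| <= lambda_k (lexprod g h) 3)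
  /\
  (exists (T1 T2 : finType) (g : rel T1) (h : rel T2),
      [/\ simple_graph g /\ simple_graph h, 3 <= #|T1|, 3 <= #|T2|, connected_graph g
        & lambda_k (lexprod g h) 3 = lambda_k h 3 + lambda_k g 3 * #|T2|]).
Proof.
split; first exact: lexprod_lower_bound.
have path3S : simple_graph path3.
  by split=> [p q|p]; rewrite /path3; [exact: addbC | exact: addbb].
have path3_card : 3 <= #|{: option bool}| by rewrite card_option card_bool.
have card3 : 3 <= #|'I_3| by rewrite card_ord.
have empty3S : simple_graph empty3 by [].
exists (option bool), 'I_3, path3, empty3; split=> //; first exact: path3_connected.
apply/eqP; rewrite eqn_leq lexprod_lower_bound ?path3_connected // andbT.
(* Positivity of [lambda_k path3 3] makes the right side at least 3, the degree bound for the left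
   side. *)
rewrite lambda_empty3 add0n card_ord (leq_trans lambda_path3_empty3) // leq_pmull //.
by apply: lambda_k_gt0 path3_connected; rewrite path3_card.
Qed.
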